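(* Let $F,B,X,\sigma,\rho,x_0$ be as in the context (so $\sigma\in(0,1)$, $\rho\in[0,\tfrac12)$). Suppose that $\operatorname{Sol}(F,B)\neq\emptyset$ and that at every iteration $k\ge 1$ of the MAEG method there exists a stepsize $\lambda_k>0$ satisfying the stepsize condition $\lambda_k\|F(x_k)-F(y_k)\|\le\sigma\|x_k-y_k\|$. Let $\{x_k\},\{y_k\},\{u_k\}$ (together with $\{d_k\},\{\lambda_k\},\{\Lambda_k\}$) be generated by the MAEG method, and for $k\ge 0$ let $$\mathcal{L}_k=\langle u_k-y_k,d_k\rangle-\tfrac12(1-2\rho)\Lambda_k\|d_k\|^2 .$$ Then: (i) $\mathcal{L}_k\ge 0$ for all $k\ge 1$. (ii) For any $x_\star\in\operatorname{Sol}(F,B)$, the sequence $\{\|u_k-x_\star\|\}_{k\ge1}$ is non-increasing. Specifically, for all $k\ge 1$, $$\|u_{k-1}-x_\star\|^2-\|u_k-x_\star\|^2\ \ge\ \bigl(\rho^2\lambda_k^2+\rho(1-2\rho)\lambda_k\Lambda_k\bigr)\|d_k\|^2\ \ge\ 0 .$$ (iii) For any $x_\star\in\operatorname{Sol}(F,B)$ and all $k\ge 1$, $$\|\mathcal{R}^c_{\mathrm{nat}}(y_k)\|\ \le\ \|d_k\|\ \le\ \frac{2\|u_k-x_\star\|}{(1-2\rho)\Lambda_k}\ \le\ \frac{2\|x_0-x_\star\|}{(1-2\rho)\Lambda_k}.$$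
   Context: Problem: $F:\operatorname{dom}F\subseteq\mathbb{R}^n\to\mathbb{R}^n$ is a monotone, continuous (single-valued) operator and $B:\mathbb{R}^n\rightrightarrows\mathbb{R}^n$ is a set-valued maximal monotone operator with $\operatorname{cl}(\operatorname{dom}B)\subseteq\operatorname{dom}F$. $\operatorname{Sol}(F,B)=\{x: 0\in F(x)+B(x)\}$. $\Pi_C$ is the Euclidean projection onto a nonempty closed convex set $C$, and $J_{T}=(\operatorname{Id}+T)^{-1}$ is the resolvent. The composite natural residual is $\mathcal{R}^c_{\mathrm{nat}}(x)=x-J_B(x-F(x))$, $x\in\operatorname{dom}F$. MAEG method. Input: $x_0\in\operatorname{cl}(\operatorname{dom}B)$, $\sigma\in(0,1)$, $\rho\in[0,\frac12)$, and a nonempty closed convex set $X$ with $\operatorname{cl}(\operatorname{dom}B)\subseteq X\subseteq\operatorname{dom}F$. Initialize $u_0=y_0=x_0$, $d_0=0$, $\Lambda_0=0$. For $k=1,2,\dots$: $$x_k=\Pi_X\bigl(\tau_ku_{k-1}+(1-\tau_k)(y_{k-1}-\lambda_kd_{k-1})\bigr),\qquad y_k=J_{\lambda_kB}\bigl(\tau_ku_{k-1}+(1-\tau_k)y_{k-1}-\lambda_kF(x_k)\bigr),$$ where $\tau_k=\frac{\lambda_k}{(1-2\rho)\Lambda_{k-1}+\lambda_k}$, $\Lambda_k=\sum_{i=1}^k\lambda_i$, and $\lambda_k>0$ is chosen so that $\lambda_k\|F(x_k)-F(y_k)\|\le\sigma\|x_k-y_k\|$; then $$d_k=\tfrac1{\lambda_k}\bigl(\tau_ku_{k-1}+(1-\tau_k)y_{k-1}-y_k\bigr)-F(x_k)+F(y_k),\qquad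 u_k=u_{k-1}-\rho\lambda_kd_k .$$ *)

(* Defs.v *)
From mathcomp Require Import all_boot all_order all_algebra.
From mathcomp Require Import all_classical all_reals all_analysis.

Set Implicit Arguments.
Unset Strict Implicit.
Unset Printing Implicit Defensive.

Import Order.TTheory GRing.Theory Num.Theory numFieldNormedType.Exports.
Local Open Scope classical_set_scope.
Local Open Scope ring_scope.

(* R^n is 'rV[R]_n.  The library norm on matrices is the max-norm, so the
   Euclidean inner product and norm are introduced here; the library topology
   on 'rV[R]_n is the usual one and is used for closures and continuity. *)
Definition dotp (R : realType) (n : nat) (a b : 'rV[R]_n) : R :=
  \sum_(i < n) a 0 i * b 0 i.

Definition enorm (R : realType) (n : nat) (a : 'rV[R]_n) : R :=
  Num.sqrt (dotp a a).

(* Set-valued operators R^n => R^n; an empty value means "outside the domain". *)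
Definition operator (R : realType) (n : nat) := 'rV[R]_n -> set 'rV[R]_n.

Section Operators.
Context (R : realType) (n : nat).
Local Notation V := 'rV[R]_n.
Implicit Types (S T : operator R n) (D C : set V) (F : V -> V).

Definition op_dom T : set V := [set x | T x !=set0].

Definition op_inv T : operator R n := fun z => [set p | T p z].

Definition op_add S T : operator R n :=
  fun x => [set a + b | a in S x & b in T x].

Definition op_scale (c : R) T : operator R n :=
  fun x => [set c *: v | v in T x].

Definition op_id : operator R n := fun x => [set x].

(* A partial single-valued map is a total function F with a domain D; the
   values of F outside D are irrelevant. *)
Definition op_fun D F : operator R n := fun x => [set v | D x /\ v = F x].

Definition monotone_op T : Prop :=
  forall p q v w, T p v -> T q w -> 0 <= dotp (v - w) (p - q).

Definition maximal_monotone T : Prop :=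
  monotone_op T /\
  forall S, monotone_op S -> (forall p, T p `<=` S p) ->
    forall p, S p `<=` T p.

Definition Sol D F T : set V := [set p | op_add (op_fun D F) T p 0].

(* (Id + T)^-1 as a set-valued operator; it is single-valued with full domain
   when T is maximal monotone, and [resolvent] is then its unique value.
   [get] returns a default point on the empty set. *)
Definition op_resolvent T : operator R n := op_inv (op_add op_id T).

Definition resolvent T (z : V) : V := get (op_resolvent T z).

Definition proj C (z : V) : V :=
  get [set p | C p /\ forall q, C q -> enorm (z - p) <= enorm (z - q)].

Definition Rnat F T (p : V) : V := p - resolvent T (p - F p).

Definition Lambda (lam : nat -> R) (k : nat) : R :=
  \sum_(1 <= i < k.+1) lam i.

(* Only used for k >= 1. *)
Definition tau (rho : R) (lam : nat -> R) (k : nat) : R :=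
  lam k / ((1 - 2 * rho) * Lambda lam k.-1 + lam k).

(* The sequences x, y, u, d and stepsizes lam (lam 0 is unused) form a run of
   the method; iteration k >= 1 is written at index k.+1. *)
Record MAEG F T (X : set V) (sigma rho : R) (x0 : V)
    (x y u d : nat -> V) (lam : nat -> R) : Prop := {
  maeg_x0 : x 0%N = x0;
  maeg_y0 : y 0%N = x0;
  maeg_u0 : u 0%N = x0;
  maeg_d0 : d 0%N = 0;
  maeg_x : forall k, x k.+1 =
    proj X (tau rho lam k.+1 *: u k +
      (1 - tau rho lam k.+1) *: (y k - lam k.+1 *: d k));
  maeg_y : forall k, y k.+1 =
    resolvent (op_scale (lam k.+1) T)
      (tau rho lam k.+1 *: u k + (1 - tau rho lam k.+1) *: y k
        - lam k.+1 *: F (x k.+1));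
  maeg_lam_gt0 : forall k, 0 < lam k.+1;
  maeg_stepsize : forall k,
    lam k.+1 * enorm (F (x k.+1) - F (y k.+1))
      <= sigma * enorm (x k.+1 - y k.+1);
  maeg_d : forall k, d k.+1 =
    (lam k.+1)^-1 *:
      (tau rho lam k.+1 *: u k + (1 - tau rho lam k.+1) *: y k - y k.+1)
    - F (x k.+1) + F (y k.+1);
  maeg_u : forall k, u k.+1 = u k - (rho * lam k.+1) *: d k.+1
}.

Definition Lyap (rho : R) (lam : nat -> R) (y u d : nat -> V) (k : nat) : R :=
  dotp (u k - y k) (d k)
  - 2^-1 * (1 - 2 * rho) * Lambda lam k * enorm (d k) ^+ 2.

End Operators.

(* Main.v *)
Require Import Defs.
From mathcomp Require Import all_boot all_order all_algebra.
From mathcomp Require Import all_classical all_reals all_analysis.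
From mathcomp Require Import ring lra.
Set Implicit Arguments.
Unset Strict Implicit.
Unset Printing Implicit Defensive.
Import Order.TTheory GRing.Theory Num.Theory numFieldNormedType.Exports.
Local Open Scope classical_set_scope.
Local Open Scope ring_scope.

(** The claims follow from one scalar inequality per iteration,
    L_k >= (1 - tau_k) L_(k-1), with L_0 = 0 ([lyapunov_step], [Lyap_ge0]).
    Put e = tau_k u_(k-1) + (1 - tau_k) y_(k-1) - y_k.  Two facts enter.
    - d_k lies in (F + B)(y_k) ([direction_sum]), so that
      <d_k - d_(k-1), y_k - y_(k-1)> >= 0 for k >= 2 by monotonicity; for k = 1
      the weight of this product is a multiple of Lambda_0 = 0.
    - The point y_k lies in X, and a projection onto X does not increase the
      distance to points of X.  The stepsize rule then gives
      |e - lambda_k d_k| <= sigma |x_k - y_k| <= |e - (1 - tau_k) lambda_k d_(k-1)|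
      ([stepsize_projection]).
    The choice of tau_k is the one for which L_k - (1 - tau_k) L_(k-1) is
    a combination with nonnegative coefficients of this product and of the
    difference of the squares of the outer norms.

    For a solution xs, monotonicity of F + B together with L_k >= 0 gives
    <d_k, u_k - xs> >= (1 - 2 rho) Lambda_k |d_k|^2 / 2 ([solution_gap]).
    Expanding |u_(k-1) - xs|^2 with u_(k-1) = u_k + rho lambda_k d_k yields the
    Fejer inequality, and Cauchy-Schwarz yields the rate for |d_k|.  The residual
    bound compares y_k with the resolvent point by monotonicity of B
    ([enorm_Rnat_le]).

    All of this presupposes that the resolvent and the projection, which are
    defined by choice, take the intended values.  For the projection this is
    compactness ([proj_exists]).  For the resolvent it is the theorem of Minty
    ([minty]): p + T(p) contains z for some p.  After a translation, one seeks p
    such that (p, -p) is monotonically related to the graph of T, that is,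
    |p - (q - w)/2|^2 <= <q, w> + |(q - w)/2|^2 for all (q, w) in the graph.
    The right side, extended to convex combinations of (q, w, <q, w>), is
    nonnegative because T is monotone, and it is strongly convex in (q - w)/2;
    the limit p of a minimizing sequence satisfies the required inequality
    ([strongly_convex_gap], [monotone_related_point]). *)

(** * The Euclidean inner product *)

Section Euclidean.
Context (R : realType) (n : nat).
Implicit Types (a b c p q w z : 'rV[R]_n) (k : R).

Lemma dotpC a b : dotp a b = dotp b a.
Proof. by apply: eq_bigr => i _; rewrite mulrC. Qed.

Lemma dotpDl a b c : dotp (a + b) c = dotp a c + dotp b c.
Proof. by rewrite -big_split; apply: eq_bigr => i _; rewrite !mxE mulrDl. Qed.

Lemma dotpZl k a b : dotp (k *: a) b = k * dotp a b.
Proof. by rewrite mulr_sumr; apply: eq_bigr => i _; rewrite !mxE mulrA. Qed.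

Lemma dotpNl a b : dotp (- a) b = - dotp a b.
Proof. by rewrite -scaleN1r dotpZl mulN1r. Qed.

Lemma dotpDr a b c : dotp c (a + b) = dotp c a + dotp c b.
Proof. by rewrite dotpC dotpDl !(dotpC c). Qed.

Lemma dotpZr k a b : dotp a (k *: b) = k * dotp a b.
Proof. by rewrite dotpC dotpZl dotpC. Qed.

Lemma dotpNr a b : dotp a (- b) = - dotp a b.
Proof. by rewrite dotpC dotpNl dotpC. Qed.

Lemma dot0p a : dotp 0 a = 0.
Proof. by rewrite -(scale0r 0) dotpZl mul0r. Qed.

Definition dotpE := (dotpDl, dotpDr, dotpNl, dotpNr, dotpZl, dotpZr).

Lemma dotp_ge0 a : 0 <= dotp a a.
Proof. by apply: sumr_ge0 => i _; rewrite -expr2 sqr_ge0. Qed.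

Lemma enorm_ge0 a : 0 <= enorm a.
Proof. exact: sqrtr_ge0. Qed.

Lemma sqr_enorm a : enorm a ^+ 2 = dotp a a.
Proof. by rewrite sqr_sqrtr ?dotp_ge0. Qed.

Lemma ler_enorm a b : (enorm a <= enorm b) = (dotp a a <= dotp b b).
Proof. by rewrite ler_sqrt // dotp_ge0. Qed.

Lemma sqr_coord_le a i : a 0 i ^+ 2 <= dotp a a.
Proof.
rewrite /dotp (bigD1 i) //= expr2 lerDl.
by apply: sumr_ge0 => j _; rewrite -expr2 sqr_ge0.
Qed.

Lemma dotp_eq0 a : dotp a a = 0 -> a = 0.
Proof.
move=> aa0; apply/rowP => i; rewrite mxE; apply/eqP.
by rewrite -sqrf_eq0 eq_le sqr_ge0 -aa0 sqr_coord_le.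
Qed.

Lemma dotp_le_enorm a b : dotp a b <= enorm a * enorm b.
Proof.
have [/dotp_eq0 ->|bb0] := eqVneq (dotp b b) 0.
  by rewrite dotpC dot0p mulr_ge0 ?enorm_ge0.
rewrite -sqrtrM ?dotp_ge0 // (le_trans (ler_norm _)) //.
rewrite -sqrtr_sqr ler_wsqrtr //.
have b0 : 0 < dotp b b by rewrite lt_def bb0 dotp_ge0.
have := dotp_ge0 (dotp b b *: a - dotp a b *: b).
rewrite !dotpE (dotpC b a) => H.
rewrite -subr_ge0 -(pmulr_rge0 _ b0); lra.
Qed.

Lemma enormB a b : enorm (a - b) = enorm (b - a).
Proof. by rewrite /enorm -(opprB b a) dotpNl dotpNr opprK. Qed.

(** The topology comes from the max-norm; this carries Euclidean estimates over
    to it. *)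
Lemma mx_norm_le_enorm a : `|a| <= enorm a.
Proof.
rewrite [`|a|]mx_normrE; apply/bigmax_leP; split=> [|[i j] _ /=].
  exact: enorm_ge0.
by rewrite (ord1 i) -sqrtr_sqr ler_wsqrtr // sqr_coord_le.
Qed.

Lemma cvg_dotp (T : Type) (G : set_system T) (FG : Filter G)
    (f g : T -> 'rV[R]_n) a b :
  f @ G --> a -> g @ G --> b -> dotp (f t) (g t) @[t --> G] --> dotp a b.
Proof.
move=> fa gb; apply: cvg_big => [|i _]; first exact: add_continuous.
apply: cvgM.
- exact: (cvg_comp f (fun v => v 0 i) fa (@coord_continuous _ 1 n 0 i a)).
- exact: (cvg_comp g (fun v => v 0 i) gb (@coord_continuous _ 1 n 0 i b)).
Qed.

End Euclidean.

(** * The theorem of Minty *)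

Section Minty.
Context (R : realType) (n : nat).
Local Notation V := 'rV[R]_n.
Implicit Types (p q w z : V) (S T : operator R n).

(** The functional m + |a|^2 grows quadratically away from its minimizer.  As
    E need not be closed, p is obtained as the limit of the components a along
    a minimizing sequence, which is Cauchy by strong convexity. *)
Lemma strongly_convex_gap (E : V -> R -> Prop) :
  (exists a m, E a m) ->
  (forall (t : R) a m b l, 0 < t -> t < 1 -> E a m -> E b l ->
     E (t *: a + (1 - t) *: b) (t * m + (1 - t) * l)) ->
  (forall a m, E a m -> 0 <= m + dotp a a) ->
  exists p, forall a m, E a m -> dotp (a - p) (a - p) <= m + dotp a a.
Proof.
move=> [a0 [m0 Ea0]] Econv Ege0.
pose W := [set s | exists a m, E a m /\ s = m + dotp a a].
have infW : has_inf W.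
  split; first by exists (m0 + dotp a0 a0), a0, m0.
  by exists 0 => _ [a [m [Ea ->]]]; exact: Ege0.
pose M := inf W.
have leM a m : E a m -> M <= m + dotp a a.
  by move=> Ea; apply: (ge_inf infW.2); exists a, m.
have M_ge0 : 0 <= M.
  by apply: lb_le_inf; [exact: infW.1 | move=> _ [a [m [Ea ->]]]; exact: Ege0].
(* The minimality of M along a segment, with the defect of strong convexity. *)
have gap (t : R) a m b l : 0 < t -> t < 1 -> E a m -> E b l ->
    t * (1 - t) * dotp (a - b) (a - b) <=
    t * (m + dotp a a - M) + (1 - t) * (l + dotp b b - M).
  move=> t0 t1 Ea Eb; have := leM _ _ (Econv t _ _ _ _ t0 t1 Ea Eb).
  rewrite !dotpE (dotpC b a); lra.
have /choice[e eP] (k : nat) : exists e : V * R,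
    E e.1 e.2 /\ e.2 + dotp e.1 e.1 <= M + k.+1%:R^-1.
  have [|_ [a [m [Ea ->]]] /ltW] := @inf_adherent _ W k.+1%:R^-1 _ infW.
    by rewrite invr_gt0.
  by exists (a, m).
pose s k := (e k).1.
(* gap at the midpoint bounds distances between near-minimizers. *)
have close k l : (k <= l)%N -> dotp (s k - s l) (s k - s l) <= 4 / k.+1%:R.
  move=> kl; have [Ek ek] := eP k; have [El el] := eP l.
  have := gap 2^-1 _ _ _ _ _ _ Ek El.
  have : l.+1%:R^-1 <= k.+1%:R^-1 :> R by rewrite lef_pV2 ?posrE ?ler_nat.
  rewrite -/(s k) -/(s l) in ek el *.
  move: ek el; move: (k.+1%:R^-1) (l.+1%:R^-1) (dotp (_ - _) _) => rk rl D.
  by move=> ek el rlk H; have {}H := H ltac:(lra) ltac:(lra); lra.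
have cvs : cvgn s.
  apply: cauchy_cvg; apply: cauchy_exP => eps eps0.
  have [k _ kP] : \forall k \near \oo, 4 / k.+1%:R < eps ^+ 2.
    have : (4 * harmonic k) @[k --> \oo] --> (4 * 0 : R).
      by apply: cvgM; [exact: cvg_cst | exact: cvg_harmonic].
    rewrite mulr0 => /cvgr_lt; apply; exact: exprn_gt0.
  exists (s k); exists k => // l /= kl.
  rewrite mx_norm_ball /=.
  apply: le_lt_trans (mx_norm_le_enorm _) _.
  rewrite -(ltr_pXn2r (_ : 0 < 2)%N) ?nnegrE ?enorm_ge0 ?(ltW eps0)//.
  by rewrite sqr_enorm (le_lt_trans (close _ _ kl)) // kP /=.
(* The inequality gap at s k, divided by t; the limits k -> oo and then t -> 0
   are taken in this order. *)
pose p := limn s; exists p => a m Ea.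
set D := dotp _ _; set G := m + dotp a a.
have lim_gap (t : R) : 0 < t -> t < 1 -> (1 - t) * D <= G - M.
  move=> t0 t1; rewrite -(ler_pM2l t0) mulrA.
  have cvD : dotp (a - s k) (a - s k) @[k --> \oo] --> D.
    by apply: cvg_dotp; apply: cvgB => //; exact: cvg_cst.
  have cvl : t * (1 - t) * dotp (a - s k) (a - s k) @[k --> \oo] -->
      t * (1 - t) * D by apply: cvgM; first exact: cvg_cst.
  have cvr : t * (G - M) + (1 - t) * k.+1%:R^-1 @[k --> \oo] -->
      t * (G - M) + (1 - t) * 0.
    apply: cvgD; first exact: cvg_cst.
    by apply: cvgM; [exact: cvg_cst | exact: cvg_harmonic].
  rewrite -[leRHS]addr0 -(mulr0 (1 - t)).
  apply: (ler_cvg_to cvl cvr); apply: nearW => k.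
  have [Ek ek] := eP k; apply: le_trans (gap _ _ _ _ _ t0 t1 Ea Ek) _.
  by rewrite lerD2l ler_pM2l ?subr_gt0// lerBlDl.
rewrite leNgt; apply/negP => GD.
have D0 : 0 < D by apply: le_lt_trans GD; exact: Ege0.
have t0 : 0 < (D - G) / (2 * D) by rewrite divr_gt0 ?mulr_gt0 ?subr_gt0.
have G0 : 0 <= G by exact: Ege0.
have t1 : (D - G) / (2 * D) < 1 by rewrite ltr_pdivrMr ?mulr_gt0 //; lra.
(* This t makes (1 - t) D the midpoint of D and G, which exceeds G >= G - M. *)
have := lim_gap _ t0 t1.
have -> : (1 - (D - G) / (2 * D)) * D = (D + G) / 2 by field; rewrite gt_eqF.
lra.
Qed.

(** The convex hull of the points (q, w, <q, w>) for (q, w) in the graph of S.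
    The inductive form lets bi-affine inequalities be lifted from the graph to
    the hull one argument at a time, without weighted sums. *)
Inductive mixture S : V -> V -> R -> Prop :=
| mixture_graph q w : S q w -> mixture S q w (dotp q w)
| mixture_conv (t : R) q1 w1 m1 q2 w2 m2 : 0 < t -> t < 1 ->
    mixture S q1 w1 m1 -> mixture S q2 w2 m2 ->
    mixture S (t *: q1 + (1 - t) *: q2) (t *: w1 + (1 - t) *: w2)
      (t * m1 + (1 - t) * m2).

(** On the graph this is monotonicity expanded; both sides are affine in each of
    the two triples, hence it passes to the hull by induction on each. *)
Lemma mixture_monotone S q1 w1 m1 q2 w2 m2 : monotone_op S ->
  mixture S q1 w1 m1 -> mixture S q2 w2 m2 ->
  dotp q1 w2 + dotp q2 w1 <= m1 + m2.
Proof.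
move=> Smono mix1; elim: mix1 q2 w2 m2 => {q1 w1 m1}.
- move=> q w Sqw q2 w2 m2; elim=> {q2 w2 m2}.
  + move=> q' w' Sqw'; have := Smono _ _ _ _ Sqw Sqw'.
    by rewrite !dotpE !(dotpC w) !(dotpC w'); lra.
  + by move=> t q1 w1 m1 q2 w2 m2 t0 t1 _ IH1 _ IH2; rewrite !dotpE; nra.
- move=> t q1 w1 m1 q2 w2 m2 t0 t1 _ IH1 _ IH2 q w m mix.
  by have {}IH1 := IH1 _ _ _ mix; have {}IH2 := IH2 _ _ _ mix; rewrite !dotpE; nra.
Qed.

(** The inclusion 0 in p + S(p), weakened to a monotone relation with the graph;
    for a maximal S the two agree. *)
Lemma monotone_related_point S : monotone_op S ->
  exists p, forall q w, S q w -> 0 <= dotp (- p - w) (p - q).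
Proof.
move=> Smono.
have [[[q0 w0] S0]|Sempty] := pselect (exists g : V * V, S g.1 g.2); last first.
  by exists 0 => q w Sqw; case: Sempty; exists (q, w).
pose E a m := exists q w, mixture S q w m /\ a = 2^-1 *: (q - w).
have [|||p pP] := @strongly_convex_gap E.
- exists (2^-1 *: (q0 - w0)), (dotp q0 w0), q0, w0; split=> //.
  exact: mixture_graph.
- move=> t a m b l t0 t1 [q1 [w1 [mix1 ->]]] [q2 [w2 [mix2 ->]]].
  exists (t *: q1 + (1 - t) *: q2), (t *: w1 + (1 - t) *: w2).
  split; first exact: mixture_conv.
  by apply/rowP => i; rewrite !mxE; ring.
- move=> _ m [q [w [mix ->]]].
  (* <q, w> + |(q - w)/2|^2 = |(q + w)/2|^2, and m >= <q, w> on the hull. *)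
  have := mixture_monotone Smono mix mix.
  have := dotp_ge0 (q + w); rewrite !dotpE !(dotpC w q); lra.
- exists p => q w Sqw.
  have := pP (2^-1 *: (q - w)) (dotp q w).
  have E1 : E (2^-1 *: (q - w)) (dotp q w).
    by exists q, w; split=> //; exact: mixture_graph.
  move=> /(_ E1).
  by rewrite !dotpE !(dotpC w) (dotpC p q); lra.
Qed.

(** Adding (p, v) to the graph of T keeps it monotone, so by maximality it is
    there already. *)
Lemma maximal_monotone_mem T p v : maximal_monotone T ->
  (forall q w, T q w -> 0 <= dotp (v - w) (p - q)) -> T p v.
Proof.
move=> [Tmono Tmax] pv.
pose S : operator R n := fun q => T q `|` [set w | q = p /\ w = v].
apply: (Tmax S); [|by move=> q w; left|by right].
move=> q1 q2 w1 w2 [T1|[-> ->]] [T2|[-> ->]].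
- exact: Tmono.
- by have := pv _ _ T1; rewrite -[w1 - v]opprB -[q1 - p]opprB dotpNl dotpNr opprK.
- exact: pv.
- by rewrite subrr dot0p.
Qed.

Lemma minty T z : maximal_monotone T -> exists p, T p (z - p).
Proof.
move=> Tmax.
have [p pP] : exists p, forall q w, T q (w + z) -> 0 <= dotp (- p - w) (p - q).
  apply: (@monotone_related_point (fun q w => T q (w + z))) => q1 q2 w1 w2 T1 T2.
  by have := Tmax.1 _ _ _ _ T1 T2; rewrite opprD addrACA subrr addr0.
exists p; apply: maximal_monotone_mem => // q w Tqw.
by have := pP q (w - z); rewrite subrK opprB addrA (addrC z); exact.
Qed.

Lemma resolvent_mem T z : maximal_monotone T ->
  T (resolvent T z) (z - resolvent T z).
Proof.
move=> Tmax; have [p Tp] := minty z Tmax.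
have : op_resolvent T z (resolvent T z).
  by apply: getPex; exists p, p => //; exists (z - p) => //; rewrite addrC subrK.
by move: (resolvent T z) => r [_ -> [v Tv <-]]; rewrite addrAC subrr add0r.
Qed.

Lemma maximal_monotone_scale T k : 0 < k -> maximal_monotone T ->
  maximal_monotone (op_scale k T).
Proof.
move=> k0 [Tmono Tmax]; split.
  move=> p q _ _ [v Tv <-] [w Tw <-].
  by rewrite -scalerBr dotpZl pmulr_rge0 //; exact: Tmono.
move=> S Smono TS p v Sv; exists (k^-1 *: v); last first.
  by rewrite scalerA mulfV ?gt_eqF // scale1r.
apply: maximal_monotone_mem => // q w Tqw.
have Skw : S q (k *: w) by apply: TS; exists w.
have := Smono _ _ _ _ Sv Skw.
have -> : v - k *: w = k *: (k^-1 *: v - w).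
  by rewrite scalerBr scalerA mulfV ?gt_eqF // scale1r.
by rewrite dotpZl pmulr_rge0.
Qed.

End Minty.

(** * The projection onto a closed convex set *)

Section Projection.
Context (R : realType) (n : nat).
Local Notation V := 'rV[R]_n.

Lemma continuous_enorm_sub (z : V) : continuous (fun q : V => enorm (z - q)).
Proof.
move=> q; apply: (@cvg_comp _ _ _ (fun r => dotp (z - r) (z - r)) Num.sqrt _
  (nbhs (dotp (z - q) (z - q)))).
  by apply: (@cvg_dotp _ _ _ (nbhs q)); apply: cvgB => //; exact: cvg_cst.
exact: sqrt_continuous.
Qed.

(** The part of C within distance |z - q0| of z, for some q0 in C, is compact. *)
Lemma proj_exists (C : set V) (z : V) : C !=set0 -> closed C ->
  exists p, C p /\ forall q, C q -> enorm (z - p) <= enorm (z - q).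
Proof.
move=> [q0 Cq0] Ccl.
pose A := C `&` [set q | enorm (z - q) <= enorm (z - q0)].
have Acl : closed A.
  apply: closedI => //; apply: (@preimage_closed _ _ _
    [set r : R | r <= enorm (z - q0)]).
    by move=> q _; exact: continuous_enorm_sub.
  exact: closed_le.
have Abd : bounded_set A.
  exists (`|z| + enorm (z - q0)); split; first exact: num_real.
  move=> r rM q [_ /= zq]; rewrite -(subKr z q) (le_trans (ler_normB _ _)) //.
  rewrite (le_trans _ (ltW rM)) // lerD2l.
  exact: le_trans (mx_norm_le_enorm _) zq.
have [||p /set_mem[Cp pz] pmin] := @EVT_min_rV R n (fun q => enorm (z - q))
  A _ (bounded_closed_compact Abd Acl).
- by exists q0; split => //=.
- by apply: continuous_subspaceT; exact: continuous_enorm_sub.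
exists p; split=> // q Cq; have [zq|/ltW zq] := leP (enorm (z - q)) (enorm (z - q0)).
- by apply: pmin; exact/mem_set.
- exact: le_trans pz zq.
Qed.

Lemma projP (C : set V) (z : V) : C !=set0 -> closed C ->
  C (Defs.proj C z) /\ forall q, C q -> enorm (z - Defs.proj C z) <= enorm (z - q).
Proof. by move=> C0 Ccl; exact: getPex (@proj_exists C z C0 Ccl). Qed.

(** The vectors z - p and q - p form an angle of at least a right angle at the
    projection p of z, hence the side opposite to it is the longest. *)
Lemma proj_dist_le (C : set V) (z q : V) : C !=set0 -> closed C ->
  convex_set (C : set (convex_lmodType V)) -> C q ->
  enorm (q - Defs.proj C z) <= enorm (q - z).
Proof.
move=> C0 Ccl Cconv Cq; have [] := @projP C z C0 Ccl.
move: (Defs.proj C z) => p Cp pmin.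
have seg (t : R) : 0 < t -> t < 1 -> C (t *: q + (1 - t) *: p).
  move=> t0 t1; apply: set_mem.
  exact: (Cconv q p (Itv01 (ltW t0) (ltW t1)) (mem_set Cq) (mem_set Cp)).
have half (t : R) : 0 < t -> t < 1 ->
    2 * dotp (z - p) (q - p) <= t * dotp (q - p) (q - p).
  move=> t0 t1; have := pmin _ (seg t t0 t1); rewrite ler_enorm.
  have -> : z - (t *: q + (1 - t) *: p) = (z - p) - t *: (q - p).
    by apply/rowP => i; rewrite !mxE; ring.
  move: (z - p) (q - p) => a b; rewrite !dotpE (dotpC b) => ab.
  rewrite -(ler_pM2l t0); lra.
have obtuse : dotp (z - p) (q - p) <= 0.
  rewrite leNgt; apply/negP => H.
  have D0 := dotp_ge0 (q - p).
  set D := dotp (q - p) (q - p) in half D0.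
  set h := dotp _ _ in half H.
  have h0 : 0 < 2 * h + D by lra.
  (* A step t with t D < h, where minimality requires 2 h <= t D. *)
  have t0 : 0 < h / (2 * h + D) by rewrite divr_gt0.
  have t1 : h / (2 * h + D) < 1 by rewrite ltr_pdivrMr //; lra.
  have := half _ t0 t1; rewrite mulrAC ler_pdivlMr //; nra.
rewrite ler_enorm.
have -> : q - z = (q - p) - (z - p) by rewrite opprB addrA subrK.
have := dotp_ge0 (z - p).
move: obtuse; move: (q - p) (z - p) => a b; rewrite !dotpE (dotpC b); lra.
Qed.
End Projection.

(** * The sum operator and the natural residual *)

Section SumOperator.
Context (R : realType) (n : nat).
Implicit Types (S T : operator R n) (D : set 'rV[R]_n) (F : 'rV[R]_n -> 'rV[R]_n).

Lemma monotone_op_add S T :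
  monotone_op S -> monotone_op T -> monotone_op (op_add S T).
Proof.
move=> Smono Tmono p q _ _ [a Sa [b Tb <-]] [a' Sa' [b' Tb' <-]].
rewrite opprD addrACA dotpDl addr_ge0 ?(Smono _ _ _ _ Sa Sa') //.
exact: Tmono.
Qed.

(** With r the residual at p, monotonicity of T between p and the resolvent point
    p - r reads <v - r, r> >= 0, hence |r| <= |v|. *)
Lemma enorm_Rnat_le D F T p v : maximal_monotone T ->
  op_add (op_fun D F) T p v -> enorm (Rnat F T p) <= enorm v.
Proof.
move=> Tmax [_ [_ ->] [b Tb <-]]; rewrite /Rnat.
have := Tmax.1 _ _ _ _ Tb (resolvent_mem (p - F p) Tmax).
set r := p - resolvent _ _.
have -> : b - (p - F p - resolvent T (p - F p)) = (F p + b) - r.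
  by apply/rowP => i; rewrite !mxE; ring.
move: (F p + b) r => v1 r; rewrite !dotpE subr_ge0 ler_enorm => rr.
have := dotp_ge0 (v1 - r); rewrite !dotpE (dotpC r v1); lra.
Qed.

End SumOperator.

(** * One iteration of the method and its consequences *)

Section Iteration.
Context (R : realType) (n : nat).
Local Notation V := 'rV[R]_n.

(** With s = c A + l, the difference of the two sides is
    (c / l) A <d - d', y - y'> + (s / (2 l^2)) (|e - (1 - tau) l d'|^2 - |e - l d|^2).
    The coefficient A of the monotonicity hypothesis vanishes at the first
    iteration, where d' = 0 stands for no element of the operator. *)
Lemma lyapunov_step (rho A l : R) (u' y' d' y d : V) :
  let c := 1 - 2 * rho in
  let tau := l / (c * A + l) in
  let e := tau *: u' + (1 - tau) *: y' - y in
  0 < c -> 0 <= A -> 0 < l ->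
  0 <= A * dotp (d - d') (y - y') ->
  enorm (e - l *: d) <= enorm (e - ((1 - tau) * l) *: d') ->
  (1 - tau) * (dotp (u' - y') d' - 2^-1 * c * A * dotp d' d') <=
  dotp (u' - (rho * l) *: d - y) d - 2^-1 * c * (A + l) * dotp d d.
Proof.
move=> c tau e c0 A0 l0 mono.
have s0 : 0 < c * A + l by rewrite ltr_wpDl // mulr_ge0 // ltW.
(* The five points enter through the differences U = u' - y' and g = y - y' only;
   in U, g, d and d' the claim is a polynomial identity. *)
have -> : e = tau *: (u' - y') - (y - y').
  by apply/rowP => i; rewrite !mxE; ring.
have -> : u' - (rho * l) *: d - y = (u' - y') - (rho * l) *: d - (y - y').
  by apply/rowP => i; rewrite !mxE; ring.
move: (u' - y') (y - y') mono => U g mono; rewrite ler_enorm.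
set e' := tau *: U - g => near.
have near' : 0 <= dotp (e' - ((1 - tau) * l) *: d') (e' - ((1 - tau) * l) *: d')
    - dotp (e' - l *: d) (e' - l *: d) by rewrite subr_ge0.
rewrite -subr_ge0.
have -> : dotp (U - (rho * l) *: d - g) d - 2^-1 * c * (A + l) * dotp d d -
    (1 - tau) * (dotp U d' - 2^-1 * c * A * dotp d' d') =
    c / l * (A * dotp (d - d') g) + (c * A + l) / (2 * l ^+ 2) *
    (dotp (e' - ((1 - tau) * l) *: d') (e' - ((1 - tau) * l) *: d')
    - dotp (e' - l *: d) (e' - l *: d)).
  rewrite /e' !dotpE !(dotpC _ U) !(dotpC _ g) /tau /c.
  field.
  by rewrite !gt_eqF.
by rewrite addr_ge0 // mulr_ge0 // ?divr_ge0 // ltW // ?mulr_gt0 // exprn_gt0.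
Qed.

Context (domF : set V) (F : V -> V) (B : operator R n) (X : set V).
Context (sigma rho : R) (x0 : V) (x y u d : nat -> V) (lam : nat -> R).
Context (F_mono : monotone_op (op_fun domF F)) (B_max : maximal_monotone B).
Context (domBF : closure (op_dom B) `<=` domF).
Context (sigma_lt1 : sigma < 1) (rho_ge0 : 0 <= rho) (rho_lt : rho < 2^-1).
Context (X_neq0 : X !=set0) (X_closed : closed X).
Context (X_convex : convex_set (X : set (convex_lmodType V))).
Context (domBX : closure (op_dom B) `<=` X).
Context (run : MAEG F B X sigma rho x0 x y u d lam).

Let c_gt0 : 0 < 1 - 2 * rho. Proof. by move: rho_lt; lra. Qed.

Lemma LambdaS k : Lambda lam k.+1 = Lambda lam k + lam k.+1.
Proof. by rewrite /Lambda big_nat_recr. Qed.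

Lemma Lambda_ge0 k : 0 <= Lambda lam k.
Proof.
elim: k => [|k IH]; first by rewrite /Lambda big_geq.
by rewrite LambdaS addr_ge0 // ltW // (maeg_lam_gt0 run).
Qed.

Lemma Lambda_gt0 k : 0 < Lambda lam k.+1.
Proof. by rewrite LambdaS ltr_wpDl ?Lambda_ge0 // (maeg_lam_gt0 run). Qed.

(** The resolvent inclusion at step k + 1, read in terms of d. *)
Lemma direction_mem k : B (y k.+1) (d k.+1 - F (y k.+1)).
Proof.
have l0 := maeg_lam_gt0 run k.
have := resolvent_mem (tau rho lam k.+1 *: u k + (1 - tau rho lam k.+1) *: y k
  - lam k.+1 *: F (x k.+1)) (maximal_monotone_scale l0 B_max).
rewrite -(maeg_y run) => -[v Bv vE]; rewrite (maeg_d run) addrK.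
suff <- : v = (lam k.+1)^-1 *: (tau rho lam k.+1 *: u k +
    (1 - tau rho lam k.+1) *: y k - y k.+1) - F (x k.+1) by [].
apply: (scalerI (lt0r_neq0 l0)); rewrite vE scalerBr scalerA mulfV ?gt_eqF //.
by rewrite scale1r addrAC.
Qed.

Lemma iterate_dom k : closure (op_dom B) (y k.+1).
Proof. by apply: subset_closure; eexists; exact: direction_mem. Qed.

Lemma direction_sum k : op_add (op_fun domF F) B (y k.+1) (d k.+1).
Proof.
exists (F (y k.+1)); first by split=> //; apply: domBF; exact: iterate_dom.
by exists (d k.+1 - F (y k.+1)); [exact: direction_mem | rewrite addrC subrK].
Qed.

(** The left side is lambda |F x - F y|, which the stepsize rule bounds by |x - y|;
    the right side is the distance from y to the point projected to obtain x. *)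
Lemma stepsize_projection k t e : t = tau rho lam k.+1 ->
  e = t *: u k + (1 - t) *: y k - y k.+1 ->
  enorm (e - lam k.+1 *: d k.+1) <= enorm (e - ((1 - t) * lam k.+1) *: d k).
Proof.
move=> tE eE; have l0 := maeg_lam_gt0 run k.
have -> : e - lam k.+1 *: d k.+1 = lam k.+1 *: (F (x k.+1) - F (y k.+1)).
  rewrite (maeg_d run) -tE -eE scalerDr scalerBr scalerA mulfV ?gt_eqF //.
  by apply/rowP => i; rewrite !mxE; ring.
rewrite {1}/enorm dotpZl dotpZr mulrA -expr2 sqrtrM ?sqr_ge0 // sqrtr_sqr.
rewrite gtr0_norm //; apply: le_trans (maeg_stepsize run k) _.
apply: (@le_trans _ _ (enorm (x k.+1 - y k.+1))).
  by rewrite ler_piMl ?enorm_ge0 // ltW.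
rewrite enormB (maeg_x run) -tE.
have Xy : X (y k.+1) by apply: domBX; exact: iterate_dom.
apply: le_trans (proj_dist_le _ X_neq0 X_closed X_convex Xy) _.
rewrite enormB eE; set a := (X in enorm X); set b := (X in _ <= enorm X).
suff -> : a = b by [].
by apply/rowP => i; rewrite !mxE; ring.
Qed.

Lemma LyapE k : Lyap rho lam y u d k = dotp (u k - y k) (d k) -
  2^-1 * (1 - 2 * rho) * Lambda lam k * dotp (d k) (d k).
Proof. by rewrite /Lyap sqr_enorm. Qed.

Lemma Lyap_ge0 k : 0 <= Lyap rho lam y u d k.
Proof.
elim: k => [|k IH].
  by rewrite LyapE (maeg_d0 run) dotpC !dot0p !mulr0 subr0.
have l0 := maeg_lam_gt0 run k; have A0 := Lambda_ge0 k.
have tau1 : tau rho lam k.+1 <= 1.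
  by rewrite ler_pdivrMr ?mul1r ?lerDr ?ltr_wpDl // mulr_ge0 // ltW.
apply: le_trans (_ : (1 - tau rho lam k.+1) * Lyap rho lam y u d k <= _).
  by rewrite mulr_ge0 // subr_ge0.
rewrite !LyapE LambdaS (maeg_u run); apply: lyapunov_step => //.
  case: k {IH l0 tau1} A0 => [|k] A0.
    by rewrite /Lambda big_geq // mul0r.
  apply: mulr_ge0 => //.
  exact: (monotone_op_add F_mono B_max.1 (direction_sum _) (direction_sum _)).
exact: stepsize_projection.
Qed.

(** Split <d, u - xs> at y: the part <d, u - y> is controlled by the Lyapunov
    value, and <d, y - xs> >= 0 by monotonicity, as 0 lies in (F + B)(xs). *)
Lemma solution_gap xs k : Sol domF F B xs ->
  2^-1 * (1 - 2 * rho) * Lambda lam k.+1 * dotp (d k.+1) (d k.+1) <=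
  dotp (d k.+1) (u k.+1 - xs).
Proof.
move=> sol.
have := monotone_op_add F_mono B_max.1 (direction_sum k) sol.
have := Lyap_ge0 k.+1; rewrite LyapE subr0 subr_ge0 dotpC => Lk mono.
have -> : u k.+1 - xs = (u k.+1 - y k.+1) + (y k.+1 - xs).
  by rewrite addrA subrK.
by rewrite dotpDr -[leLHS]addr0 lerD.
Qed.

Lemma fejer xs k : Sol domF F B xs ->
  (rho ^+ 2 * lam k.+1 ^+ 2
    + rho * (1 - 2 * rho) * lam k.+1 * Lambda lam k.+1) * enorm (d k.+1) ^+ 2
  <= enorm (u k - xs) ^+ 2 - enorm (u k.+1 - xs) ^+ 2.
Proof.
move=> sol; rewrite !sqr_enorm.
have l0 := maeg_lam_gt0 run k.
have -> : u k - xs = (u k.+1 - xs) + (rho * lam k.+1) *: d k.+1.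
  by rewrite (maeg_u run); apply/rowP => i; rewrite !mxE; ring.
have rl0 : 0 <= rho * lam k.+1 by rewrite mulr_ge0 // ltW.
have := ler_wpM2l rl0 (solution_gap k sol).
move: (u k.+1 - xs) (d k.+1) => a b; rewrite !dotpE (dotpC a b); lra.
Qed.

Lemma decrease_ge0 k :
  0 <= (rho ^+ 2 * lam k.+1 ^+ 2
    + rho * (1 - 2 * rho) * lam k.+1 * Lambda lam k.+1) * enorm (d k.+1) ^+ 2.
Proof.
have l0 := ltW (maeg_lam_gt0 run k).
have A0 := Lambda_ge0 k.+1; have c0 := ltW c_gt0.
by rewrite mulr_ge0 ?sqr_ge0 // addr_ge0 // !mulr_ge0 ?sqr_ge0.
Qed.

Lemma fejer_nonincreasing xs j k : Sol domF F B xs -> (j <= k)%N ->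
  enorm (u k - xs) <= enorm (u j - xs).
Proof.
move=> sol /subnK <-; elim: (k - j)%N => // i IH; apply: le_trans IH.
rewrite addSn ler_enorm -!sqr_enorm -subr_ge0.
exact: le_trans (decrease_ge0 _) (fejer _ sol).
Qed.

Lemma direction_rate xs k : Sol domF F B xs ->
  enorm (d k.+1) <= 2 * enorm (u k.+1 - xs) / ((1 - 2 * rho) * Lambda lam k.+1).
Proof.
move=> sol; have A0 := Lambda_gt0 k.
have [d0|dn0] := eqVneq (enorm (d k.+1)) 0.
  by rewrite d0 divr_ge0 ?mulr_ge0 ?enorm_ge0 // ltW.
have dgt0 : 0 < enorm (d k.+1) by rewrite lt_def dn0 enorm_ge0.
rewrite ler_pdivlMr ?mulr_gt0 // -(ler_pM2l dgt0).
have := le_trans (solution_gap k sol) (dotp_le_enorm _ _).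
rewrite -sqr_enorm; lra.
Qed.

End Iteration.

Theorem theorem1 (R : realType) (n : nat)
  (domF : set 'rV[R]_n) (F : 'rV[R]_n -> 'rV[R]_n) (B : operator R n)
  (X : set 'rV[R]_n) (sigma rho : R) (x0 : 'rV[R]_n)
  (x y u d : nat -> 'rV[R]_n) (lam : nat -> R)
  (F_mono : monotone_op (op_fun domF F))
  (F_cont : {within domF, continuous F})
  (B_max : maximal_monotone B)
  (domBF : closure (op_dom B) `<=` domF)
  (x0_in : closure (op_dom B) x0)
  (sigma_gt0 : 0 < sigma) (sigma_lt1 : sigma < 1)
  (rho_ge0 : 0 <= rho) (rho_lt : rho < 2^-1)
  (X_neq0 : X !=set0) (X_closed : closed X)
  (X_convex : convex_set (X : set (convex_lmodType 'rV[R]_n)))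
  (domBX : closure (op_dom B) `<=` X) (X_domF : X `<=` domF)
  (Sol_neq0 : Sol domF F B !=set0)
  (run : MAEG F B X sigma rho x0 x y u d lam) :
  (forall k : nat, (1 <= k)%N -> 0 <= Lyap rho lam y u d k)
  /\
  (forall xs : 'rV[R]_n, Sol domF F B xs ->
    (forall j k : nat, (1 <= j)%N -> (j <= k)%N ->
      enorm (u k - xs) <= enorm (u j - xs))
    /\
    (forall k : nat, (1 <= k)%N ->
      enorm (u k.-1 - xs) ^+ 2 - enorm (u k - xs) ^+ 2
        >= (rho ^+ 2 * lam k ^+ 2
            + rho * (1 - 2 * rho) * lam k * Lambda lam k) * enorm (d k) ^+ 2
      /\
      (rho ^+ 2 * lam k ^+ 2
        + rho * (1 - 2 * rho) * lam k * Lambda lam k) * enorm (d k) ^+ 2 >= 0))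
  /\
  (forall xs : 'rV[R]_n, Sol domF F B xs ->
    forall k : nat, (1 <= k)%N ->
      [/\ enorm (Rnat F B (y k)) <= enorm (d k),
          enorm (d k) <= 2 * enorm (u k - xs) / ((1 - 2 * rho) * Lambda lam k)
        & 2 * enorm (u k - xs) / ((1 - 2 * rho) * Lambda lam k)
          <= 2 * enorm (x0 - xs) / ((1 - 2 * rho) * Lambda lam k)]).
Proof.
have Fejer := fejer F_mono B_max domBF sigma_lt1 rho_ge0 rho_lt X_neq0 X_closed
  X_convex domBX run.
have noninc := fejer_nonincreasing F_mono B_max domBF sigma_lt1 rho_ge0 rho_lt
  X_neq0 X_closed X_convex domBX run.
split=> [k _|]; first exact: (Lyap_ge0 F_mono B_max domBF sigma_lt1 rho_lt
  X_neq0 X_closed X_convex domBX run).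
split=> xs sol.
- split=> [j k _ jk|[//|k] _]; first exact: noninc.
  by split; [exact: Fejer | exact: (decrease_ge0 rho_ge0 rho_lt run)].
- move=> [//|k] _; split.
  + exact: enorm_Rnat_le B_max (direction_sum B_max domBF run k).
  + exact: (direction_rate F_mono B_max domBF sigma_lt1 rho_lt X_neq0 X_closed
      X_convex domBX run).
  + have A0 := ltW (Lambda_gt0 run k).
    have c0 : 0 <= 1 - 2 * rho by move: rho_lt; lra.
    rewrite ler_wpM2r ?invr_ge0 ?mulr_ge0 // ler_wpM2l // -(maeg_u0 run).
    exact: noninc.
Qed.
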